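(* Let $\gamma$ be an infinite countable ordinal. Then the class $\mathcal{L}_{\prec\boldsymbol{\gamma}}=\{L: L\prec\boldsymbol{\gamma}\}$ is ccs if and only if $\gamma$ is either an (additively) indecomposable ordinal, or the successor of an indecomposable ordinal.
   Context: $L\preceq L'$ means there is an embedding $f:L\to L'$ of linear orders, i.e. $x\le_L y\iff f(x)\le_{L'}f(y)$; $L\prec L'$ means $L\preceq L'$ and $L'\not\preceq L$. $\boldsymbol{\gamma}$ is a well-order of order type $\gamma$. In $\mathcal{L}_{\prec\boldsymbol{\gamma}}$, $L$ ranges over nonempty linear orders (up to isomorphism), so this is the class of nonempty well-orders of order type $<\gamma$. A nonzero ordinal $\gamma$ is (additively) indecomposable if $\alpha+\beta<\gamma$ for all $\alpha,\beta<\gamma$. A subset $I$ of a linear order $L$ is convex if $x\le_L y\le_L z$ and $x,z\in I$ imply $y\in I$. For $A,B\subseteq L$ write $A\le_L B$ if $a\le_L b$ for all $a\in A$, $b\in B$. A class $\mathcal{L}$ of linear orders closed downward under $\preceq$ is ccs (closed under convex sums) if for all $K,K'\in\mathcal{L}$ and every family $(K'_k)_{k\in K}$ of nonempty convex subsets of $K'$ such that $k_0<_K k_1\Rightarrow K'_{k_0}\le_{K'}K'_{k_1}$ for all $k_0,k_1\in K$, we have $\sum_{k\in K}K'_k\in\mathcal{L}$, where $\sum_{k\in K}K'_k=\{(x,k): k\in K, x\in K'_k\}$ ordered antilexicographically. *)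

(* Defs.v *)
From Stdlib Require Import Relation_Definitions Relation_Operators Wellfounded.
From Stdlib Require Import FinFun ProofIrrelevance Classical.

Set Implicit Arguments.
Unset Strict Implicit.

Record LinOrd : Type := MkLinOrd {
  carrier :> Type;
  le : relation carrier;
  le_order : order carrier le;
  le_total : forall x y, le x y \/ le y x
}.

Arguments le {l} x y.

Definition lt (L : LinOrd) (x y : L) : Prop := le x y /\ x <> y.

Lemma lt_le_trans (L : LinOrd) (x y z : L) : lt x y -> le y z -> lt x z.
Proof.
  destruct (le_order L) as [_ tr an]. intros [xy ne] yz. split.
  - exact (tr _ _ _ xy yz).
  - intros e. subst z. exact (ne (an _ _ xy yz)).
Qed.

Lemma lt_not_le (L : LinOrd) (x y : L) : lt x y -> ~ le y x.
Proof.
  destruct (le_order L) as [_ _ an]. intros [xy ne] yx.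
  exact (ne (an _ _ xy yx)).
Qed.

Definition is_embedding (L L' : LinOrd) (f : L -> L') : Prop :=
  forall x y : L, le x y <-> le (f x) (f y).

Definition embeds (L L' : LinOrd) : Prop :=
  exists f : L -> L', is_embedding f.

Definition strictly_embeds (L L' : LinOrd) : Prop :=
  embeds L L' /\ ~ embeds L' L.

Definition isomorphic (L L' : LinOrd) : Prop :=
  exists f : L -> L', is_embedding f /\ Surjective f.

Section Suborder.
Variables (L : LinOrd) (P : L -> Prop).

Definition sub_le (x y : {z : L | P z}) : Prop := le (proj1_sig x) (proj1_sig y).

Lemma sub_le_order : order _ sub_le.
Proof.
  destruct (le_order L) as [re tr an]. split.
  - intros x. apply re.
  - intros x y z. apply tr.
  - intros [x px] [y py] xy yx. apply subset_eq_compat. exact (an _ _ xy yx).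
Qed.

Definition suborder : LinOrd :=
  MkLinOrd sub_le_order
    (fun x y => le_total (proj1_sig x) (proj1_sig y)).
End Suborder.

Section Antilex.
Variables L K : LinOrd.

Definition antilex_le (p q : L * K) : Prop :=
  lt (snd p) (snd q) \/ (snd p = snd q /\ le (fst p) (fst q)).

Lemma antilex_le_order : order _ antilex_le.
Proof.
  destruct (le_order L) as [reL trL anL].
  destruct (le_order K) as [reK trK anK]. split.
  - intros [x k]. right. split; [reflexivity | apply reL].
  - intros [x k] [y l] [z m]. unfold antilex_le; simpl.
    intros [kl | [<- xy]] [lm | [<- yz]].
    + left. exact (lt_le_trans kl (proj1 lm)).
    + left. exact kl.
    + left. exact lm.
    + right. split; [reflexivity | exact (trL _ _ _ xy yz)].
  - intros [x k] [y l]. unfold antilex_le; simpl.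
    intros [kl | [<- xy]] [lk | [e yx]].
    + destruct (lt_not_le kl (proj1 lk)).
    + subst l. destruct (proj2 kl eq_refl).
    + destruct (proj2 lk eq_refl).
    + rewrite (anL _ _ xy yx). reflexivity.
Qed.

Lemma antilex_le_total (p q : L * K) : antilex_le p q \/ antilex_le q p.
Proof.
  destruct p as [x k], q as [y l]. unfold antilex_le, lt; simpl.
  destruct (classic (k = l)) as [<- | ne].
  - destruct (le_total x y); [left | right]; right; split; auto.
  - destruct (le_total k l); [left | right]; left; split; auto.
Qed.

Definition antilex : LinOrd := MkLinOrd antilex_le_order antilex_le_total.
End Antilex.

Definition sum_subsets (K K' : LinOrd) (A : K -> K' -> Prop) : LinOrd :=
  suborder (L := antilex K' K) (fun p => A (snd p) (fst p)).

Definition convex (L : LinOrd) (I : L -> Prop) : Prop :=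
  forall x y z : L, le x y -> le y z -> I x -> I z -> I y.

Definition set_le (L : LinOrd) (A B : L -> Prop) : Prop :=
  forall a b : L, A a -> B b -> le a b.

(* Members of the classes under consideration are nonempty, so downward closure
   only concerns nonempty orders. *)
Definition downward_closed (C : LinOrd -> Prop) : Prop :=
  forall L L' : LinOrd, inhabited L -> embeds L L' -> C L' -> C L.

Definition ccs (C : LinOrd -> Prop) : Prop :=
  downward_closed C /\
  forall (K K' : LinOrd) (A : K -> K' -> Prop),
    C K -> C K' ->
    (forall k, (exists x, A k x) /\ convex (A k)) ->
    (forall k0 k1 : K, lt k0 k1 -> set_le (A k0) (A k1)) ->
    C (sum_subsets A).

Definition class_below (G L : LinOrd) : Prop :=
  inhabited L /\ strictly_embeds L G.

(* Ordinals are represented by well-orders; equality of ordinals is [isomorphic]. *)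

Record Ordinal : Type := MkOrdinal {
  ord_lin :> LinOrd;
  ord_wf : well_founded (@lt ord_lin)
}.

Definition ord_lt (a b : Ordinal) : Prop :=
  exists c : b, isomorphic a (suborder (L := b) (fun x => lt x c)).

Section Sum.
Variables L M : LinOrd.

Definition sum_le : relation (L + M) := le_AsB L M le le.

Lemma sum_le_order : order _ sum_le.
Proof.
  destruct (le_order L) as [reL trL anL].
  destruct (le_order M) as [reM trM anM]. split.
  - intros [x | x]; constructor; auto.
  - intros x y z xy yz.
    destruct xy; inversion yz; subst; constructor; eauto.
  - intros x y xy yx. destruct xy; inversion yx; subst; f_equal; auto.
Qed.

Lemma sum_le_total (x y : L + M) : sum_le x y \/ sum_le y x.
Proof.
  destruct x as [x | x], y as [y | y].
  - destruct (le_total x y); [left | right]; constructor; auto.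
  - left; constructor.
  - right; constructor.
  - destruct (le_total x y); [left | right]; constructor; auto.
Qed.

Definition lin_sum : LinOrd := MkLinOrd sum_le_order sum_le_total.
End Sum.

Lemma lin_sum_wf (a b : Ordinal) : well_founded (@lt (lin_sum a b)).
Proof.
  apply wf_incl with (R2 := le_AsB a b (@lt a) (@lt b)).
  - intros x y [xy ne]. destruct xy; constructor; split; auto; congruence.
  - apply wf_disjoint_sum; apply ord_wf.
Qed.

Definition ord_add (a b : Ordinal) : Ordinal := MkOrdinal (@lin_sum_wf a b).

Lemma unit_le_order : order unit (fun _ _ => True).
Proof. split; repeat intros []; auto. Qed.

Definition unit_lin : LinOrd := MkLinOrd unit_le_order (fun _ _ => or_introl I).

Lemma unit_lin_wf : well_founded (@lt unit_lin).
Proof. intros []. constructor. intros [] [_ ne]. destruct (ne eq_refl). Qed.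

Definition ord_one : Ordinal := MkOrdinal unit_lin_wf.

Definition ord_succ (a : Ordinal) : Ordinal := ord_add a ord_one.

Definition indecomposable (g : Ordinal) : Prop :=
  inhabited g /\
  forall a b : Ordinal, ord_lt a g -> ord_lt b g -> ord_lt (ord_add a b) g.

Definition ord_infinite (g : Ordinal) : Prop := ~ Finite g.

Definition ord_countable (g : Ordinal) : Prop :=
  exists f : g -> nat, Injective f.

(* Main.v *)
Require Import Defs.
From Stdlib Require Import Wellfounded ProofIrrelevance ClassicalEpsilon.
From Stdlib Require Import FunctionalExtensionality.

Set Implicit Arguments.
Unset Strict Implicit.

(** Well-orders are comparable ([well_order_comparison]), so [a < gamma] for
    ordinals means that [gamma] does not embed into [a], and the class consists
    of the nonempty well-orders into which [gamma] does not embed.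

    If the class is ccs, then [m + 1 < gamma] and [k < gamma] imply
    [m + k < gamma] ([ccs_add]): take the convex sum indexed by [k] whose first
    summand is all of [m + 1] and whose other summands are the top point of
    [m + 1].  If [gamma] has no maximum, [m < gamma] gives [m + 1 < gamma], and
    [gamma] is indecomposable.  If [gamma = delta + 1] and [a, b < delta] had
    [delta <= a + b], then [gamma <= a + (b + 1)], contrary to the above with
    [m = a] and [k = b + 1].

    Conversely, let [gamma] be [delta] or [delta + 1] with [delta]
    indecomposable.  The order condition on the summands makes a convex sum of
    subsets of [K'] indexed by [K] a chain in the product order on [K' * K], so
    an embedding of [gamma] into it consists of monotone maps [g] into [K] and
    [h] into [K'] that are jointly injective.  At every point of [delta], one
    of [g] and [h] takes a smaller value than at all later points of [gamma].
    As [delta] is indivisible ([tail_embeddable_indivisible]), it embeds into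
    the set of such points for one of the two maps, say [g]; composing with [g],
    and keeping the value of [g] at the top of [gamma] if there is one, gives an
    embedding of [gamma] into [K] ([embeds_of_product_chain]).  So if [gamma]
    embeds neither into [K] nor into [K'], it does not embed into the sum. *)

(** * Linear orders and embeddings *)

Lemma le_refl (L : LinOrd) (x : L) : le x x.
Proof. apply (le_order L). Qed.

Lemma le_trans (L : LinOrd) (x y z : L) : le x y -> le y z -> le x z.
Proof. destruct (le_order L) as [_ tr _]. apply tr. Qed.

Lemma le_antisym (L : LinOrd) (x y : L) : le x y -> le y x -> x = y.
Proof. destruct (le_order L) as [_ _ an]. apply an. Qed.

Lemma lt_irrefl (L : LinOrd) (x : L) : ~ lt x x.
Proof. intros [_ ne]. exact (ne eq_refl). Qed.

Lemma le_lt_trans (L : LinOrd) (x y z : L) : le x y -> lt y z -> lt x z.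
Proof.
  intros xy [yz ne]. split.
  - exact (le_trans xy yz).
  - intros <-. exact (ne (le_antisym yz xy)).
Qed.

Lemma lt_trans (L : LinOrd) (x y z : L) : lt x y -> lt y z -> lt x z.
Proof. intros [xy _]. exact (le_lt_trans xy). Qed.

Lemma not_le_lt (L : LinOrd) (x y : L) : ~ le x y -> lt y x.
Proof.
  intros n. destruct (le_total x y) as [h | h]; [contradiction |].
  split; [exact h |]. intros ->. exact (n (le_refl x)).
Qed.

Lemma le_or_lt (L : LinOrd) (x y : L) : le x y \/ lt y x.
Proof. destruct (classic (le x y)); auto using not_le_lt. Qed.

Lemma le_lt_or_eq (L : LinOrd) (x y : L) : le x y -> lt x y \/ x = y.
Proof. intros h. destruct (classic (x = y)); [right | left; split]; auto. Qed.

Definition strictly_monotone (L M : LinOrd) (f : L -> M) : Prop :=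
  forall x y, lt x y -> lt (f x) (f y).

Lemma strictly_monotone_embedding (L M : LinOrd) (f : L -> M) :
  strictly_monotone f -> is_embedding f.
Proof.
  intros mf x y. split.
  - intros h. destruct (le_lt_or_eq h) as [h' | <-].
    + apply mf, h'.
    + apply le_refl.
  - intros h. destruct (le_or_lt x y) as [h' | h']; [exact h' |].
    destruct (lt_not_le (mf _ _ h') h).
Qed.

Lemma embedding_strictly_monotone (L M : LinOrd) (f : L -> M) :
  is_embedding f -> strictly_monotone f.
Proof.
  intros ef x y h. apply not_le_lt. intros h'.
  apply ef in h'. exact (lt_not_le h h').
Qed.

Lemma strictly_monotone_embeds (L M : LinOrd) (f : L -> M) :
  strictly_monotone f -> embeds L M.
Proof. intros mf. exists f. exact (strictly_monotone_embedding mf). Qed.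

Lemma embeds_strictly_monotone (L M : LinOrd) :
  embeds L M -> exists f : L -> M, strictly_monotone f.
Proof. intros [f ef]. exists f. exact (embedding_strictly_monotone ef). Qed.

Lemma embeds_refl (L : LinOrd) : embeds L L.
Proof. exists (fun x => x). intros x y. reflexivity. Qed.

Lemma embeds_trans (L M N : LinOrd) : embeds L M -> embeds M N -> embeds L N.
Proof.
  intros [f ef] [g eg]. exists (fun x => g (f x)). intros x y.
  rewrite (ef x y). apply eg.
Qed.

Lemma suborder_lt (L : LinOrd) (P : L -> Prop) (x y : suborder P) :
  lt x y <-> lt (proj1_sig x) (proj1_sig y).
Proof.
  split.
  - intros h. apply not_le_lt. exact (lt_not_le h).
  - intros h. apply not_le_lt. exact (lt_not_le h).
Qed.

Lemma embeds_suborder_incl (L : LinOrd) (P : L -> Prop) : embeds (suborder P) L.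
Proof. exists (@proj1_sig _ _). intros x y. reflexivity. Qed.

Lemma embeds_suborder_map (L M : LinOrd) (P : L -> Prop) (Q : M -> Prop)
    (f : L -> M) :
  strictly_monotone f -> (forall x, P x -> Q (f x)) ->
  embeds (suborder P) (suborder Q).
Proof.
  intros mf h.
  apply strictly_monotone_embeds with
    (f := fun x : suborder P =>
            exist Q (f (proj1_sig x)) (h _ (proj2_sig x)) : suborder Q).
  intros x y xy. apply suborder_lt. apply mf. apply suborder_lt, xy.
Qed.

Lemma embeds_into_suborder (L M : LinOrd) (Q : M -> Prop) (f : L -> M) :
  strictly_monotone f -> (forall x, Q (f x)) -> embeds L (suborder Q).
Proof.
  intros mf h.
  apply strictly_monotone_embeds with
    (f := fun x => exist Q (f x) (h x) : suborder Q).
  intros x y xy. apply suborder_lt. apply mf, xy.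
Qed.

Lemma embeds_suborder_inv (L M : LinOrd) (Q : M -> Prop) :
  embeds L (suborder Q) ->
  exists f : L -> M, strictly_monotone f /\ forall x, Q (f x).
Proof.
  intros h. destruct (embeds_strictly_monotone h) as [f mf].
  exists (fun x => proj1_sig (f x)). split.
  - intros x y xy. apply suborder_lt, mf, xy.
  - intros x. apply proj2_sig.
Qed.

Lemma isomorphic_embeds (L M : LinOrd) : isomorphic L M -> embeds L M.
Proof. intros [f [ef _]]. exists f. exact ef. Qed.

Lemma isomorphic_embeds_inv (L M : LinOrd) : isomorphic L M -> embeds M L.
Proof.
  intros [f [ef sf]].
  exists (fun y => proj1_sig (constructive_indefinite_description _ (sf y))).
  intros x y.
  destruct (constructive_indefinite_description _ (sf x)) as [x' <-].
  destruct (constructive_indefinite_description _ (sf y)) as [y' <-].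
  symmetry. apply ef.
Qed.

(** * Well-orders *)

Definition well_ordered (L : LinOrd) : Prop := well_founded (@lt L).

Lemma well_ordered_embeds (L M : LinOrd) :
  embeds L M -> well_ordered M -> well_ordered L.
Proof.
  intros h wM. destruct (embeds_strictly_monotone h) as [f mf].
  apply wf_incl with (R2 := fun x y => lt (f x) (f y)).
  - exact mf.
  - apply wf_inverse_image, wM.
Qed.

Lemma well_ordered_suborder (L : LinOrd) (P : L -> Prop) :
  well_ordered L -> well_ordered (suborder P).
Proof. apply well_ordered_embeds, embeds_suborder_incl. Qed.

Lemma exists_least (L : LinOrd) (P : L -> Prop) :
  well_ordered L -> (exists x, P x) ->
  exists x, P x /\ forall y, P y -> le x y.
Proof.
  intros wL [x px]. induction (wL x) as [x _ IH].
  destruct (classic (exists y, P y /\ lt y x)) as [[y [py yx]] | n].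
  - exact (IH y yx py).
  - exists x. split; [exact px |]. intros y py.
    destruct (le_or_lt x y) as [h | h]; [exact h |].
    destruct n. exists y. auto.
Qed.

(** The initial segment of the elements below [c]. *)
Notation below c := (suborder (fun x => lt x c)).

Lemma strictly_monotone_ge (L : LinOrd) (f : L -> L) (x : L) :
  well_ordered L -> strictly_monotone f -> le x (f x).
Proof.
  intros wL mf. induction (wL x) as [x _ IH].
  destruct (le_or_lt x (f x)) as [h | h]; [exact h |].
  destruct (lt_not_le (mf _ _ h) (IH _ h)).
Qed.

Lemma not_embeds_below (L : LinOrd) (c : L) :
  well_ordered L -> ~ embeds L (below c).
Proof.
  intros wL h. destruct (embeds_suborder_inv h) as [f [mf hf]].
  exact (lt_not_le (hf c) (strictly_monotone_ge c wL mf)).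
Qed.

(** Comparability.  The map sending [w] to the least strict upper bound of the
    images of its predecessors either is defined everywhere, and is then an
    isomorphism onto an initial segment of [V], or is first undefined at some
    [w], and then maps the segment below [w] onto [V]. *)
Lemma well_order_comparison (W V : LinOrd) :
  well_ordered W -> well_ordered V ->
  (exists c : V, isomorphic W (below c)) \/ embeds V W.
Proof.
  intros wW wV.
  destruct (classic (inhabited V)) as [iV | nV].
  2: { right. exists (fun v => False_rect W (nV (inhabits v))).
       intros v. destruct (nV (inhabits v)). }
  set (lsub := fun (w : W) (g : forall y, lt y w -> V) (v : V) =>
         (forall y (h : lt y w), lt (g y h) v) /\
         forall v', (forall y (h : lt y w), lt (g y h) v') -> le v v').
  set (F := fun w g => epsilon iV (@lsub w g)).
  set (f := Fix wW (fun _ => V) F).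
  assert (fE : forall w : W, f w = F w (fun (y : W) _ => f y)).
  { intros w. refine (Fix_eq wW (fun _ => V) F _ w). intros x g g' e. f_equal.
    extensionality y. extensionality h. apply e. }
  set (bounded := fun w => exists v, forall y, lt y w -> lt (f y) v).
  assert (spec : forall w, bounded w ->
            (forall y, lt y w -> lt (f y) (f w)) /\
            forall v, (forall y, lt y w -> lt (f y) v) -> le (f w) v).
  { intros w bw. rewrite (fE w). unfold F.
    apply (epsilon_spec iV (lsub w (fun y _ => f y))).
    destruct (exists_least wV bw) as [v [h1 h2]].
    exists v. split; assumption. }
  (* Wherever [f] meets its specification, its image is downward closed. *)
  assert (init : forall w v, (forall y, le y w -> bounded y) -> le v (f w) ->
            exists y, le y w /\ f y = v).
  { intros w v bw vw.
    destruct (exists_least wW (ex_intro (fun y => le v (f y)) w vw))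
      as [y [vy ym]].
    exists y. assert (yw := ym w vw). split; [exact yw |].
    apply le_antisym; [| exact vy].
    apply spec; [exact (bw y yw) |]. intros z zy. apply not_le_lt. intros vz.
    exact (lt_not_le zy (ym z vz)). }
  destruct (classic (forall w, bounded w)) as [all | nall].
  - assert (mf : strictly_monotone f).
    { intros x y. apply spec, all. }
    destruct (classic (exists v, forall w, f w <> v)) as [ev | sf].
    + left. destruct (exists_least wV ev) as [c [hc lc]]. exists c.
      assert (fc : forall w, lt (f w) c).
      { intros w. apply not_le_lt. intros cw.
        destruct (init w c (fun y _ => all y) cw) as [y [_ e]].
        exact (hc y e). }
      exists (fun w => exist _ (f w) (fc w) : below c). split.
      * intros x y. apply (strictly_monotone_embedding mf).
      * intros [v vc].
        destruct (classic (exists w, f w = v)) as [[w <-] | n].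
        -- exists w. apply subset_eq_compat. reflexivity.
        -- destruct (lt_not_le vc). apply lc. intros w e. apply n. exists w. exact e.
    + right. apply isomorphic_embeds_inv. exists f. split.
      * exact (strictly_monotone_embedding mf).
      * intros v. apply NNPP. intros n. apply sf. exists v. intros w e.
        apply n. exists w. exact e.
  - right. apply not_all_ex_not in nall.
    destruct (exists_least wW nall) as [w [nb lw]].
    assert (bl : forall y, lt y w -> bounded y).
    { intros y yw. apply NNPP. intros n. exact (lt_not_le yw (lw y n)). }
    assert (onto : forall v, exists y, lt y w /\ f y = v).
    { intros v. apply NNPP. intros n. apply nb. exists v. intros y yw.
      apply not_le_lt. intros vy. apply n.
      destruct (init y v) as [z [zy e]]; [| exact vy |].
      - intros z zy. apply bl. exact (le_lt_trans zy yw).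
      - exists z. split; [exact (le_lt_trans zy yw) | exact e]. }
    exists (fun v => proj1_sig (constructive_indefinite_description _ (onto v))).
    apply strictly_monotone_embedding. intros u v uv.
    destruct (constructive_indefinite_description _ (onto u)) as [x [xw <-]].
    destruct (constructive_indefinite_description _ (onto v)) as [y [yw <-]].
    simpl. apply not_le_lt. intros yx.
    destruct (le_lt_or_eq yx) as [h | ->].
    + apply spec in h; [| exact (bl x xw)]. exact (lt_not_le uv (proj1 h)).
    + exact (lt_irrefl uv).
Qed.

Lemma ord_lt_iff (a b : Ordinal) : ord_lt a b <-> ~ embeds b a.
Proof.
  split.
  - intros [c h] ba. apply (not_embeds_below (c := c) (@ord_wf b)).
    exact (embeds_trans ba (isomorphic_embeds h)).
  - intros n.
    destruct (well_order_comparison (@ord_wf a) (@ord_wf b)) as [h | h].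
    + exact h.
    + contradiction.
Qed.

Lemma class_below_iff (G : Ordinal) (L : LinOrd) :
  well_ordered L -> class_below G L <-> inhabited L /\ ~ embeds G L.
Proof.
  intros wL. split.
  - intros [i [_ n]]. auto.
  - intros [i n]. split; [exact i |]. split; [| exact n].
    apply (ord_lt_iff (MkOrdinal wL) G) in n. destruct n as [c h].
    exact (embeds_trans (isomorphic_embeds h) (@embeds_suborder_incl _ _)).
Qed.

(** Every nonempty class of well-orders has a least member for [embeds]. *)
Lemma exists_least_well_order (Q : LinOrd -> Prop) :
  (forall L, Q L -> well_ordered L) -> (exists L, Q L) ->
  exists L, Q L /\ forall M, Q M -> embeds L M.
Proof.
  intros wQ [W qW].
  destruct (classic (forall M, Q M -> embeds W M)) as [h | n].
  { exists W. auto. }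
  assert (key : forall L M, Q L -> Q M -> ~ embeds L M ->
            exists c : L, embeds M (below c)).
  { intros L M qL qM nLM.
    destruct (well_order_comparison (wQ M qM) (wQ L qL)) as [[c h] | h].
    - exists c. exact (isomorphic_embeds h).
    - contradiction. }
  assert (ex : exists c : W, exists M, Q M /\ embeds M (below c)).
  { apply NNPP. intros n'. apply n. intros M qM. apply NNPP. intros nM.
    destruct (key W M qW qM nM) as [c h]. apply n'. exists c, M. auto. }
  destruct (exists_least (wQ W qW) ex) as [c [[L [qL hL]] lc]].
  exists L. split; [exact qL |]. intros M qM. apply NNPP. intros nM.
  destruct (key L M qL qM nM) as [d h].
  destruct (embeds_suborder_inv hL) as [f [mf hf]].
  apply (lt_not_le (hf d)). apply lc. exists M. split; [exact qM |].
  apply (embeds_trans h). apply (embeds_suborder_map mf).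
  intros x xd. exact (mf _ _ xd).
Qed.

(** * Indivisibility of indecomposable well-orders *)

(** The property of embedding into each of one's own final segments; for
    nonempty well-orders it amounts to additive indecomposability. *)
Definition tail_embeddable (W : LinOrd) : Prop :=
  forall c : W, embeds W (suborder (fun x => le c x)).

Lemma indecomposable_tail (g : Ordinal) : indecomposable g -> tail_embeddable g.
Proof.
  intros [_ ind] c. apply NNPP. intros n.
  set (a := MkOrdinal (well_ordered_suborder (P := fun x => lt x c) (@ord_wf g))).
  set (b := MkOrdinal (well_ordered_suborder (P := fun x => le c x) (@ord_wf g))).
  assert (h : ord_lt (ord_add a b) g).
  { apply ind; apply ord_lt_iff; [| exact n].
    exact (not_embeds_below (@ord_wf g)). }
  apply ord_lt_iff in h. apply h.
  apply strictly_monotone_embeds with (f := fun x : g =>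
    match excluded_middle_informative (lt x c) with
    | left p => inl (exist _ x p)
    | right p => inr (exist _ x (NNPP _ (fun q => p (not_le_lt q))))
    end : ord_add a b).
  intros x y xy.
  destruct (excluded_middle_informative (lt x c)) as [p | p];
    destruct (excluded_middle_informative (lt y c)) as [q | q].
  - split; [constructor; exact (proj1 xy) |].
    intros e. inversion e. subst y. exact (lt_irrefl xy).
  - split; [constructor |]. discriminate.
  - destruct p. exact (lt_trans xy q).
  - split; [constructor; exact (proj1 xy) |].
    intros e. inversion e. subst y. exact (lt_irrefl xy).
Qed.

(** A covering of [W] by two sets, neither of which contains a copy of [W]. *)
Definition bad_cover (W : LinOrd) (A B : W -> Prop) : Prop :=
  (forall x, A x \/ B x) /\ ~ embeds W (suborder A) /\ ~ embeds W (suborder B).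

Lemma bad_cover_sym (W : LinOrd) (A B : W -> Prop) :
  bad_cover A B -> bad_cover B A.
Proof.
  intros [h [nA nB]]. split; [| auto]. intros x. destruct (h x); auto.
Qed.

Lemma bad_cover_preimage (W : LinOrd) (A B : W -> Prop) (e : W -> W) :
  strictly_monotone e -> bad_cover A B ->
  bad_cover (fun x => A (e x)) (fun x => B (e x)).
Proof.
  intros me [h [nA nB]]. split; [intros x; apply h |].
  split; intros k.
  - apply nA, (embeds_trans k), (embeds_suborder_map me). auto.
  - apply nB, (embeds_trans k), (embeds_suborder_map me). auto.
Qed.

Lemma not_embeds_initial_part (W : LinOrd) (S : W -> Prop) (c : W) :
  well_ordered W -> (exists s, S s) ->
  embeds (suborder S) (suborder (fun x => S x /\ le c x)) ->
  ~ embeds (suborder S) (suborder (fun x => S x /\ lt x c)).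
Proof.
  intros wW [s hs] t h.
  destruct (embeds_suborder_inv t) as [f [_ hf]].
  destruct (hf (exist _ s hs)) as [Sb cb].
  set (b := exist _ _ Sb : suborder S).
  apply (not_embeds_below (c := b) (well_ordered_suborder (P := S) wW)).
  destruct (embeds_suborder_inv h) as [g [mg hg]].
  apply embeds_into_suborder with
    (f := fun x => exist _ (g x) (proj1 (hg x)) : suborder S).
  - intros x y xy. apply suborder_lt, mg, xy.
  - intros x. apply suborder_lt. exact (lt_le_trans (proj2 (hg x)) cb).
Qed.

(** Take a counterexample [W] of least order type and a bad cover [A], [B] with
    [A] of least type and then [B] of least type.  Shifting the cover into final
    segments shows that [A] and [B] embed into their own tails, so [B], being
    shorter than [W], is indivisible.  As [A] embeds into [B], the order [B] then
    embeds into no proper initial segment of [W], so [W] embeds into [B]. *)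
Lemma tail_embeddable_indivisible (W : LinOrd) (A B : W -> Prop) :
  well_ordered W -> tail_embeddable W -> ~ bad_cover A B.
Proof.
  intros wW0 tW0 bad0.
  destruct (@exists_least_well_order (fun W => well_ordered W /\
    tail_embeddable W /\ exists A B : W -> Prop, bad_cover A B))
    as [V [[wV [tV [A0 [B0 bad]]]] minV]].
  { intros L [h _]. exact h. }
  { exists W. split; [exact wW0 |]. split; [exact tW0 |]. exists A, B. exact bad0. }
  clear W A B wW0 tW0 bad0.
  destruct (@exists_least_well_order (fun L => exists A B : V -> Prop,
    bad_cover A B /\ L = suborder A)) as [LA [[A1 [B1 [bad1 ->]]] min1]].
  { intros L [A [B [_ ->]]]. exact (well_ordered_suborder wV). }
  { exists (suborder A0), A0, B0. auto. }
  destruct (@exists_least_well_order (fun L => exists A B : V -> Prop,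
    bad_cover A B /\ embeds (suborder A) (suborder A1) /\ L = suborder B))
    as [LB [[A [B [badAB [AA1 ->]]]] min2]].
  { intros L [A [B [_ [_ ->]]]]. exact (well_ordered_suborder wV). }
  { exists (suborder B1), A1, B1. auto using embeds_refl. }
  assert (minA : forall A' B' : V -> Prop, bad_cover A' B' ->
            embeds (suborder A) (suborder A')).
  { intros A' B' h. apply (embeds_trans AA1), min1. exists A', B'. auto. }
  assert (AB : embeds (suborder A) (suborder B)).
  { exact (minA B A (bad_cover_sym badAB)). }
  assert (tails : forall c : V,
    embeds (suborder A) (suborder (fun x : V => A x /\ le c x)) /\
    embeds (suborder B) (suborder (fun x : V => B x /\ le c x))).
  { intros c. destruct (embeds_suborder_inv (tV c)) as [e [me he]].
    assert (bad' := bad_cover_preimage me badAB). split.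
    - apply (embeds_trans (minA _ _ bad')).
      apply (embeds_suborder_map me). auto.
    - apply embeds_trans with (suborder (fun x => B (e x))).
      + apply min2. exists (fun x => A (e x)), (fun x => B (e x)).
        split; [exact bad' |]. split; [| reflexivity].
        apply embeds_trans with (suborder A).
        * apply (embeds_suborder_map me). auto.
        * exact AA1.
      + apply (embeds_suborder_map me). auto. }
  destruct badAB as [cov [nA nB]].
  assert (neA : exists x, A x).
  { apply NNPP. intros n. apply nB.
    apply embeds_into_suborder with (f := fun x : V => x).
    - intros x y h. exact h.
    - intros x. destruct (cov x); [| assumption]. destruct n. exists x. auto. }
  assert (neB : exists x, B x).
  { apply NNPP. intros n. apply nA.
    apply embeds_into_suborder with (f := fun x : V => x).
    - intros x y h. exact h.
    - intros x. destruct (cov x); [assumption |]. destruct n. exists x. auto. }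
  assert (tB : tail_embeddable (suborder B)).
  { intros b. apply (embeds_trans (proj2 (tails (proj1_sig b)))).
    apply strictly_monotone_embeds with
      (f := fun x : suborder (fun x => B x /\ le (proj1_sig b) x) =>
        exist (fun y => le b y)
          (exist B (proj1_sig x) (proj1 (proj2_sig x)) : suborder B)
          (proj2 (proj2_sig x)) : suborder (fun y => le b y)).
    intros x y xy. apply suborder_lt, suborder_lt. apply suborder_lt in xy.
    exact xy. }
  assert (indB : forall A' B' : suborder B -> Prop, ~ bad_cover A' B').
  { intros A' B' h. apply nB, minV.
    split; [exact (well_ordered_suborder wV) |]. split; [exact tB |].
    exists A', B'. exact h. }
  assert (nI : forall c : V, ~ embeds (suborder B) (below c)).
  { intros c h. destruct (embeds_suborder_inv h) as [f [mf hf]].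
    apply (indB (fun x => A (f x)) (fun x => B (f x))).
    split; [intros x; apply cov |]. split; intros k.
    - apply (not_embeds_initial_part wV neA (proj1 (tails c))).
      apply (embeds_trans AB), (embeds_trans k), (embeds_suborder_map mf). auto.
    - apply (not_embeds_initial_part wV neB (proj2 (tails c))).
      apply (embeds_trans k), (embeds_suborder_map mf). auto. }
  destruct (well_order_comparison (well_ordered_suborder (P := B) wV) wV)
    as [[c h] | h].
  - exact (nI c (isomorphic_embeds h)).
  - exact (nB h).
Qed.

(** * Chains in a product of two orders *)

Section Chains.
Variables (D G K : LinOrd) (i : D -> G).
Hypothesis mi : strictly_monotone i.
Hypothesis top : forall x, (exists d, i d = x) \/ forall y, le y x.

(** If [G] is [D] with at most one point added on top, and [D] embeds into the
    set of points where [g] takes a smaller value than at all later points of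
    [G], then [G] embeds into the codomain of [g]. *)
Lemma embeds_of_strict_points (g : G -> K) :
  embeds D (suborder (fun d => forall y, lt (i d) y -> lt (g (i d)) (g y))) ->
  embeds G K.
Proof.
  intros h. destruct (embeds_suborder_inv h) as [e [me he]].
  apply strictly_monotone_embeds with (f := fun x =>
    match excluded_middle_informative (exists d, i d = x) with
    | left p => g (i (e (proj1_sig (constructive_indefinite_description _ p))))
    | right _ => g x
    end).
  assert (inj : forall d d', lt (i d) (i d') -> lt d d').
  { intros d d' l. apply not_le_lt. intros l'.
    apply (strictly_monotone_embedding mi) in l'. exact (lt_not_le l l'). }
  intros x y xy.
  destruct (excluded_middle_informative (exists d, i d = x)) as [p | p].
  - destruct (constructive_indefinite_description _ p) as [d <-]. simpl.
    destruct (excluded_middle_informative (exists d, i d = y)) as [q | q].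
    + destruct (constructive_indefinite_description _ q) as [d' <-]. simpl.
      apply he, mi, me, inj, xy.
    + apply he. destruct (top y) as [q' | ty]; [contradiction |].
      split; [apply ty |]. intros E. apply q. exists (e d). exact E.
  - destruct (top x) as [p' | tx]; [contradiction |].
    destruct (lt_not_le xy (tx y)).
Qed.

End Chains.

(** By joint injectivity, at each point one of the two maps takes a smaller
    value than at all later points, so indivisibility of [D] applies. *)
Lemma embeds_of_product_chain (D G K K' : LinOrd) (i : D -> G)
    (g : G -> K) (h : G -> K') :
  well_ordered D -> tail_embeddable D -> strictly_monotone i ->
  (forall x, (exists d, i d = x) \/ forall y, le y x) ->
  (forall x y, le x y -> le (g x) (g y)) ->
  (forall x y, le x y -> le (h x) (h y)) ->
  (forall x y, g x = g y -> h x = h y -> x = y) ->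
  embeds G K \/ embeds G K'.
Proof.
  intros wD tD mi top mg mh inj.
  set (A := fun d => forall y, lt (i d) y -> lt (g (i d)) (g y)).
  set (B := fun d => forall y, lt (i d) y -> lt (h (i d)) (h y)).
  apply NNPP. intros n. apply (tail_embeddable_indivisible (A := A) (B := B) wD tD).
  split.
  - intros d. apply NNPP. intros nAB. apply not_or_and in nAB.
    destruct nAB as [nA nB].
    apply not_all_ex_not in nA. destruct nA as [y nA].
    apply not_all_ex_not in nB. destruct nB as [z nB].
    apply imply_to_and in nA, nB.
    destruct nA as [dy ny], nB as [dz nz].
    assert (ey : forall x, lt (i d) x -> le x y -> g (i d) = g x).
    { intros x dx xy. apply NNPP. intros ne. apply ny.
      apply (@lt_le_trans _ _ (g x)); [| exact (mg _ _ xy)].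
      split; [exact (mg _ _ (proj1 dx)) | exact ne]. }
    assert (ez : forall x, lt (i d) x -> le x z -> h (i d) = h x).
    { intros x dx xz. apply NNPP. intros ne. apply nz.
      apply (@lt_le_trans _ _ (h x)); [| exact (mh _ _ xz)].
      split; [exact (mh _ _ (proj1 dx)) | exact ne]. }
    (* Both maps are constant from [i d] to the smaller of [y] and [z]. *)
    destruct (le_total y z) as [yz | zy].
    + apply (proj2 dy), inj; [apply ey | apply ez]; auto using le_refl.
    + apply (proj2 dz), inj; [apply ey | apply ez]; auto using le_refl.
  - split; intros k; apply n; [left | right].
    + exact (embeds_of_strict_points mi top k).
    + exact (embeds_of_strict_points mi top k).
Qed.

(** * Convex sums *)

Lemma well_ordered_antilex (L K : LinOrd) :
  well_ordered L -> well_ordered K -> well_ordered (antilex L K).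
Proof.
  intros wL wK.
  assert (h : forall k x, Acc (@lt (antilex L K)) (x, k)).
  { intros k. induction (wK k) as [k _ IHk].
    intros x. induction (wL x) as [x _ IHx].
    constructor. intros [y l] [[kl | [e yx]] ne]; simpl in *.
    - exact (IHk l kl y).
    - subst l. apply IHx. split; [exact yx |]. congruence. }
  intros [x k]. apply h.
Qed.

(** Here [G] is [D] with at most one point added on top, and [D] is
    indecomposable. *)
Lemma class_below_ccs (D : LinOrd) (G : Ordinal) (i : D -> G) :
  well_ordered D -> tail_embeddable D -> strictly_monotone i ->
  (forall x, (exists d, i d = x) \/ forall y, le y x) ->
  ccs (class_below G).
Proof.
  intros wD tD mi top. split.
  - intros L L' iL e [_ [e' n]]. split; [exact iL |]. split.
    + exact (embeds_trans e e').
    + intros e''. exact (n (embeds_trans e'' e)).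
  - intros K K' A [[k] [eK nK]] [_ [eK' nK']] conv ord.
    assert (wK : well_ordered K) by exact (well_ordered_embeds eK (@ord_wf G)).
    assert (wK' : well_ordered K') by exact (well_ordered_embeds eK' (@ord_wf G)).
    apply class_below_iff.
    { apply well_ordered_suborder, well_ordered_antilex; assumption. }
    split.
    { destruct (conv k) as [[x hx] _]. constructor. exact (exist _ (x, k) hx). }
    intros e. destruct (embeds_suborder_inv e) as [f [mf hf]].
    destruct (@embeds_of_product_chain D G K K' i (fun x => snd (f x))
      (fun x => fst (f x)) wD tD mi top) as [h | h];
      [| | | exact (nK h) | exact (nK' h)].
    + intros x y xy. destruct (proj1 (strictly_monotone_embedding mf x y) xy)
        as [h | [-> _]]; [exact (proj1 h) | apply le_refl].
    + intros x y xy. destruct (proj1 (strictly_monotone_embedding mf x y) xy)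
        as [h | [_ h]]; [| exact h].
      exact (ord _ _ h _ _ (hf x) (hf y)).
    + intros x y e1 e2.
      assert (E : f x = f y).
      { destruct (f x), (f y). simpl in *. congruence. }
      apply le_antisym; apply (strictly_monotone_embedding mf); rewrite E;
        apply (le_refl (L := antilex K' K)).
Qed.

Lemma class_below_embeds (G H : LinOrd) :
  embeds G H -> embeds H G -> forall L, class_below G L -> class_below H L.
Proof.
  intros GH HG L [i [e n]]. split; [exact i |]. split.
  - exact (embeds_trans e GH).
  - intros h. exact (n (embeds_trans GH h)).
Qed.

Lemma ccs_ext (C C' : LinOrd -> Prop) :
  (forall L, C L <-> C' L) -> ccs C -> ccs C'.
Proof.
  intros E [d s]. split.
  - intros L L' iL e h. apply E. apply E in h. exact (d L L' iL e h).
  - intros K K' A hK hK' conv ord. apply E. apply E in hK, hK'. auto.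
Qed.

(** * Sums of ordinals *)

Lemma lin_sum_lt_inl (L M : LinOrd) (x y : L) :
  lt (inl x : lin_sum L M) (inl y : lin_sum L M) <-> lt x y.
Proof.
  split.
  - intros [h ne]. inversion h; subst. split; [assumption | congruence].
  - intros [h ne]. split; [constructor; exact h | congruence].
Qed.

Lemma lin_sum_lt_inr (L M : LinOrd) (x y : M) :
  lt (inr x : lin_sum L M) (inr y : lin_sum L M) <-> lt x y.
Proof.
  split.
  - intros [h ne]. inversion h; subst. split; [assumption | congruence].
  - intros [h ne]. split; [constructor; exact h | congruence].
Qed.

Lemma lin_sum_lt_inl_inr (L M : LinOrd) (x : L) (y : M) :
  lt (inl x : lin_sum L M) (inr y : lin_sum L M).
Proof. split; [constructor | discriminate]. Qed.

Lemma lin_sum_not_lt_inr_inl (L M : LinOrd) (x : M) (y : L) :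
  ~ lt (inr x : lin_sum L M) (inl y : lin_sum L M).
Proof. intros [h _]. inversion h. Qed.

Lemma ord_succ_top (a : Ordinal) (x : ord_succ a) : le x (inr tt : ord_succ a).
Proof. destruct x as [x | []]; [constructor | apply le_refl]. Qed.

Lemma embeds_succ_no_max (L : LinOrd) (a : Ordinal) (f : L -> ord_succ a) :
  strictly_monotone f -> forall x, (exists y, lt x y) -> exists z, f x = inl z.
Proof.
  intros mf x [y xy]. destruct (f x) as [z | []] eqn:E; [exists z; reflexivity |].
  apply mf in xy. rewrite E in xy.
  destruct (lt_not_le xy (ord_succ_top _)).
Qed.

Lemma embeds_of_succ (L : LinOrd) (a : Ordinal) (P : L -> Prop) :
  embeds L (ord_succ a) -> (forall x, P x -> exists y, lt x y) ->
  embeds (suborder P) a.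
Proof.
  intros h nm. destruct (embeds_strictly_monotone h) as [f mf].
  assert (fl := fun x : suborder P =>
    embeds_succ_no_max mf (nm _ (proj2_sig x))).
  apply strictly_monotone_embeds with (f := fun x : suborder P =>
    proj1_sig (constructive_indefinite_description _ (fl x))).
  intros x y xy. apply suborder_lt, mf in xy.
  destruct (constructive_indefinite_description _ (fl x)) as [u eu].
  destruct (constructive_indefinite_description _ (fl y)) as [v ev].
  simpl. rewrite eu, ev in xy. exact (proj1 (lin_sum_lt_inl _ _ _) xy).
Qed.

(** The sum [m + k] is realised as a convex sum of pieces of [m + 1] indexed by
    [k]: the first piece is all of [m + 1], and the others are its top. *)
Lemma ccs_add (G m k : Ordinal) :
  ccs (class_below G) -> ~ embeds G (ord_succ m) -> ~ embeds G k ->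
  ~ embeds G (ord_add m k).
Proof.
  intros [_ cs] nm nk e.
  destruct (classic (exists x : k, True)) as [ik | nik].
  2: { apply nm, (embeds_trans e).
       apply strictly_monotone_embeds with (f := fun x : ord_add m k =>
         match x with inl y => inl y | inr _ => inr tt end : ord_succ m).
       intros [x | x] [y | y] xy;
         [| destruct nik; exists y | destruct nik; exists x
          | destruct nik; exists x]; auto.
       apply lin_sum_lt_inl. apply lin_sum_lt_inl in xy. exact xy. }
  destruct (exists_least (@ord_wf k) ik) as [k0 [_ lk0]].
  set (A := fun (l : k) (x : ord_succ m) =>
         (forall l', le l l') \/ x = inr tt).
  assert (h : class_below G (sum_subsets A)).
  { apply cs.
    - apply class_below_iff; [exact (@ord_wf k) |]. split; [| exact nk].
      exact (inhabits k0).
    - apply class_below_iff; [exact (@ord_wf (ord_succ m)) |]. split; [| exact nm].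
      exact (inhabits (inr tt)).
    - intros l. split; [exists (inr tt); right; reflexivity |].
      intros x y z xy yz [h | ->] _; [left; exact h | right].
      exact (le_antisym (ord_succ_top y) xy).
    - intros l0 l1 l01 a b _ [h | ->].
      + destruct (lt_not_le l01 (h l0)).
      + apply ord_succ_top. }
  destruct h as [_ [_ n]]. apply n, (embeds_trans e).
  apply embeds_into_suborder with (f := fun x : ord_add m k =>
    match x with inl y => (inl y, k0) | inr l => (inr tt, l) end
      : antilex (ord_succ m) k).
  - intros [x | x] [y | y] xy.
    + apply lin_sum_lt_inl in xy. split.
      * right. split; [reflexivity |]. constructor. exact (proj1 xy).
      * intros E. inversion E. subst y. exact (lt_irrefl xy).
    + split; [| discriminate]. destruct (le_lt_or_eq (lk0 y I)) as [l | l].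
      * left. exact l.
      * right. split; [exact l | constructor].
    + destruct (lin_sum_not_lt_inr_inl xy).
    + apply lin_sum_lt_inr in xy. split.
      * left. exact xy.
      * intros E. inversion E. subst y. exact (lt_irrefl xy).
  - intros [x | x]; [left; intros l; exact (lk0 l I) | right; reflexivity].
Qed.

Lemma isomorphic_succ_below (G : Ordinal) (t : G) :
  (forall x, le x t) ->
  isomorphic G (ord_succ (MkOrdinal
    (well_ordered_suborder (P := fun x => lt x t) (@ord_wf G)))).
Proof.
  intros ht. set (d := MkOrdinal _).
  exists (fun x : G => match excluded_middle_informative (lt x t) with
    | left p => inl (exist _ x p)
    | right _ => inr tt
    end : ord_succ d). split.
  - apply strictly_monotone_embedding. intros x y xy.
    assert (xt := lt_le_trans xy (ht y)).
    destruct (excluded_middle_informative (lt x t)) as [p | p]; [| contradiction].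
    destruct (excluded_middle_informative (lt y t)) as [q | q].
    + apply lin_sum_lt_inl, suborder_lt. exact xy.
    + apply lin_sum_lt_inl_inr.
  - intros [[x p] | []].
    + exists x. destruct (excluded_middle_informative (lt x t)) as [p' | n];
        [| contradiction].
      f_equal. apply subset_eq_compat. reflexivity.
    + exists t. destruct (excluded_middle_informative (lt t t)) as [p | _];
        [| reflexivity]. destruct (lt_irrefl p).
Qed.

Theorem proposition7p8 (gamma : Ordinal)
    (hinf : ord_infinite gamma) (hcount : ord_countable gamma) :
  ccs (class_below gamma) <->
  indecomposable gamma \/
  (exists delta : Ordinal,
     indecomposable delta /\ isomorphic gamma (ord_succ delta)).
Proof.
  split.
  - intros hccs.
    destruct (classic (exists t : gamma, forall x, le x t)) as [[t ht] | nt].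
    + right. exists (MkOrdinal
        (well_ordered_suborder (P := fun x => lt x t) (@ord_wf gamma))).
      assert (iso := isomorphic_succ_below ht). split; [| exact iso].
      set (delta := MkOrdinal _) in *. split.
      * apply NNPP. intros n. apply hinf. exists (cons t nil). intros x. left.
        apply NNPP. intros ne. apply n. constructor. exists x.
        split; [apply ht | congruence].
      * assert (ns : forall a, ord_lt a delta -> ~ embeds gamma (ord_succ a)).
        { intros a ha h. apply ord_lt_iff in ha. apply ha.
          apply (embeds_of_succ h). intros x xt. exists t. exact xt. }
        intros a b ha hb. apply ord_lt_iff. intros h.
        (* An embedding of [delta] into [a + b] extends to one of [gamma] into
           [a + (b + 1)]. *)
        apply (ccs_add hccs (ns a ha) (ns b hb)).
        apply (embeds_trans (isomorphic_embeds iso)).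
        destruct (embeds_strictly_monotone h) as [f mf].
        apply strictly_monotone_embeds with (f := fun x : ord_succ delta =>
          match x with
          | inl d => match f d with inl u => inl u | inr v => inr (inl v) end
          | inr _ => inr (inr tt)
          end : ord_add a (ord_succ b)).
        intros [x | []] [y | []] xy.
        -- apply lin_sum_lt_inl, mf in xy.
           destruct (f x) as [u | u], (f y) as [v | v].
           ++ apply lin_sum_lt_inl. exact (proj1 (lin_sum_lt_inl _ _ _) xy).
           ++ apply lin_sum_lt_inl_inr.
           ++ destruct (lin_sum_not_lt_inr_inl xy).
           ++ apply lin_sum_lt_inr, lin_sum_lt_inl.
              exact (proj1 (lin_sum_lt_inr _ _ _) xy).
        -- destruct (f x) as [u | u].
           ++ apply lin_sum_lt_inl_inr.
           ++ apply lin_sum_lt_inr, lin_sum_lt_inl_inr.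
        -- destruct (lin_sum_not_lt_inr_inl xy).
        -- destruct (lt_irrefl xy).
    + left. split.
      * apply NNPP. intros n. apply hinf. exists nil. intros x.
        destruct n. exact (inhabits x).
      * intros a b ha hb. apply ord_lt_iff. apply ord_lt_iff in ha, hb.
        apply ccs_add; [exact hccs | | exact hb]. intros h. apply ha.
        apply embeds_trans with (suborder (fun _ : gamma => True)).
        -- apply embeds_into_suborder with (f := fun x : gamma => x); [| auto].
           intros x y xy. exact xy.
        -- apply (embeds_of_succ h). intros x _. apply NNPP. intros n.
           apply nt. exists x. intros y. apply NNPP. intros ne.
           apply n. exists y. exact (not_le_lt ne).
  - intros [ind | [delta [ind iso]]].
    + apply class_below_ccs with (D := gamma) (i := fun x => x).
      * exact (@ord_wf gamma).
      * exact (indecomposable_tail ind).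
      * intros x y xy. exact xy.
      * intros x. left. exists x. reflexivity.
    + apply ccs_ext with (C := class_below (ord_succ delta)).
      { assert (e1 := isomorphic_embeds iso).
        assert (e2 := isomorphic_embeds_inv iso).
        intros L. split; apply class_below_embeds; assumption. }
      apply class_below_ccs with (D := delta) (i := @inl delta unit).
      * exact (@ord_wf delta).
      * exact (indecomposable_tail ind).
      * intros x y xy. apply lin_sum_lt_inl. exact xy.
      * intros [x | []]; [left; exists x; reflexivity |].
        right. apply ord_succ_top.
Qed.
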